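(* Let $X$ be a nonzero finite-dimensional real vector space with norm $\rho$ and dual norm $\rho_*$. Let $\phi:[0,\infty)\to\mathbb{R}$ be finite, convex, and nondecreasing, with $L:=\lim_{r\to\infty}\phi(r)/r\in(0,\infty)$. Assume that $\gamma:=\lim_{r\to\infty}(\phi(r)-Lr)$ is finite and that $\phi(r)-Lr\neq\gamma$ for every $r\ge0$, and set $d(r)=\phi(r)-Lr-\gamma>0$. Assume that $d(r)\sim\kappa r^{-\nu}$ as $r\to\infty$ for some $\nu>0$, $\kappa>0$. Let $a>0$, $b\in X^*$ with $\rho_*(b)=aL$, $q>1$, and for $\lambda>0$ consider $$\inf\left\{at+b(z)+\frac{\lambda}{q}\rho(z)^q:\ (t,z)\in\mathbb{R}\times X,\ t\ge\phi(\rho(z))\right\},$$ whose scalar reduction is the minimization over $r\ge0$ of $$J_\lambda(r)=a\gamma+a\,d(r)+\frac{\lambda}{q}r^q.$$ Let $r_\lambda$ be any minimizer of $J_\lambda$ over $[0,\infty)$. Then, as $\lambda\downarrow0$, $$r_\lambda\sim\left(\frac{a\nu\kappa}{\lambda}\right)^{1/(\nu+q)},$$ $$a\,d(r_\lambda)\sim a\kappa\left(\frac{\lambda}{a\nu\kappa}\right)^{\nu/(\nu+q)},$$ $$\min_{r\ge0} J_\lambda(r)-a\gamma\sim\left(1+\frac{\nu}{q}\right)a\kappa\left(\frac{\lambda}{a\nu\kappa}\right)^{\nu/(\nu+q)}.$$ In particular, the regularization path escapes at rate $\lambda^{-1/(\nu+q)}$.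
   Context: The dual norm is $\rho_*(b)=\sup\{b(z):\rho(z)\le1\}$. $A\sim B$ means that the ratio $A/B$ tends to $1$ in the indicated limit. *)

(* Defs.v *)
From HB Require Import structures.
From mathcomp Require Import all_boot all_order all_algebra.
From mathcomp Require Import all_classical all_reals all_analysis.
Import Order.TTheory GRing.Theory Num.Theory.
Import numFieldNormedType.Exports.

Set Implicit Arguments.
Unset Strict Implicit.
Unset Printing Implicit Defensive.

Local Open Scope classical_set_scope.
Local Open Scope ring_scope.

(* A finite-dimensional space is a [vectType]; its norm is a separate function
   because a [vectType] carries no canonical norm. *)
Record is_norm (R : realType) (X : vectType R) (rho : X -> R) : Prop := IsNorm {
  is_norm_ge0 : forall x, 0 <= rho x;
  is_norm_eq0 : forall x, rho x = 0 -> x = 0;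
  is_normZ : forall (c : R) x, rho (c *: x) = `|c| * rho x;
  is_normD : forall x y, rho (x + y) <= rho x + rho y
}.

(* The set is nonempty, and bounded above because X is finite-dimensional, so
   this real-valued [sup] is the genuine supremum. *)
Definition dual_norm (R : realType) (X : vectType R) (rho : X -> R)
    (b : {scalar X}) : R :=
  sup [set b z | z in [set z | rho z <= 1]].

Definition asymp (R : realType) (T : Type) (F : set_system T) (f g : T -> R) :
    Prop :=
  f x / g x @[x --> F] --> (1 : R).

Definition minimizers (R : realType) (T : Type) (A : set T) (f : T -> R) :
    set T :=
  [set x | A x /\ forall y, A y -> f x <= f y].

Definition halfline (R : realType) : set R := [set r | 0 <= r].

Definition gap (R : realType) (phi : R -> R) (L gamma r : R) : R :=
  phi r - L * r - gamma.

Definition epi_constraint (R : realType) (X : vectType R) (rho : X -> R)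
    (phi : R -> R) : set (R * X) :=
  [set p | phi (rho p.2) <= p.1].

Definition reg_objective (R : realType) (X : vectType R) (rho : X -> R)
    (a : R) (b : {scalar X}) (q lambda : R) (p : R * X) : R :=
  a * p.1 + b p.2 + lambda / q * rho p.2 `^ q.

Definition J (R : realType) (phi : R -> R) (L gamma a q lambda r : R) : R :=
  a * gamma + a * gap phi L gamma r + lambda / q * r `^ q.

Definition minJ (R : realType) (phi : R -> R) (L gamma a q lambda : R) : R :=
  inf (J phi L gamma a q lambda @` @halfline R).

(* Main.v *)
(** With lambda = a nu kappa u^-(nu+q) and r = s u, the rescaled objective
    (J_lambda(r) - a gamma) / (a kappa u^-nu) converges to the profile
    s^-nu + (nu/q) s^q, whose strict minimum 1 + nu/q is at s = 1.  Comparing a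
    minimizer with the single competitor r = u shows that its profile value
    tends to the minimum.  In the variable ln s the profile exceeds its
    minimum by at least a multiple of (ln s)^2, hence s tends to 1.  Convexity
    of phi is used only to make the gap nonincreasing, so that minimizers cannot
    stay below a fixed fraction of u.

    The scalar reduction is b(z) >= -a L rho(z), with equality along the ray
    spanned by -z0, where z0 attains the dual norm. *)

Require Import Defs.
From HB Require Import structures.
From mathcomp Require Import all_boot all_order all_algebra.
From mathcomp Require Import all_classical all_reals all_analysis.
From mathcomp Require Import ring lra.
Import Order.TTheory GRing.Theory Num.Theory.
Import numFieldNormedType.Exports.
Import VectorInternalTheory.

Set Implicit Arguments.
Unset Strict Implicit.

Local Open Scope classical_set_scope.
Local Open Scope ring_scope.

(** * The dual norm is attained *)

(** Expanding in the signed basis bounds [f] by a multiple of the sup norm, and subadditivity turns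
    this bound into a Lipschitz estimate. Sublinearity covers both the norm and the functional read
    in coordinates. *)
Lemma sublinear_rV_continuous (R : realType) (n : nat) (f : 'rV[R]_n -> R) :
  (forall u v, f (u + v) <= f u + f v) ->
  (forall c u, 0 <= c -> f (c *: u) = c * f u) ->
  continuous f.
Proof.
move=> fD fZ.
(* Homogeneity is known only for nonnegative scalars, so a negative coordinate is charged to the
   opposite basis vector. *)
pose C := \sum_(i < n) (`|f (delta_mx 0 i)| + `|f (- delta_mx 0 i)|).
have f0 : f 0 = 0 by rewrite -(scale0r (0 : 'rV[R]_n)) fZ// mul0r.
have fC w : f w <= C * `|w|.
  have coord i : `|w 0 i| <= `|w|.
    rewrite [leRHS]/Num.norm /= mx_normrE; apply/bigmax_geP; right.
    by exists (ord0, i).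
  have fterm i : f (w 0 i *: delta_mx 0 i) <=
      (`|f (delta_mx 0 i)| + `|f (- delta_mx 0 i)|) * `|w|.
    apply: (@le_trans _ _
      ((`|f (delta_mx 0 i)| + `|f (- delta_mx 0 i)|) * `|w 0 i|)); last first.
      by rewrite ler_wpM2l// addr_ge0.
    rewrite mulrDl; have [w0|/ltW w0] := leP 0 (w 0 i).
      rewrite fZ// (ger0_norm w0) mulrC.
      by rewrite ler_wpDr ?mulr_ge0// ler_wpM2r ?ler_norm.
    rewrite -[w 0 i *: _]opprK -scaleNr -scalerN fZ ?oppr_ge0//.
    rewrite (ler0_norm w0) mulrC.
    by rewrite ler_wpDl ?mulr_ge0 ?oppr_ge0// ler_wpM2r ?oppr_ge0 ?ler_norm.
  rewrite [X in f X]row_sum_delta /C mulr_suml.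
  elim/big_ind2 : _ => [|x a y b xa yb|i _]; [by rewrite f0| |exact: fterm].
  by rewrite (le_trans (fD _ _))// lerD.
have C0 : 0 <= C by apply: sumr_ge0 => i _; rewrite addr_ge0.
have flip u v : `|f u - f v| <= C * `|u - v|.
  rewrite ler_norml lerNl opprB; apply/andP; split.
    rewrite lerBlDr distrC (le_trans _ (lerD (fC _) (lexx _)))//.
    by rewrite -{1}(subrK u v) fD.
  rewrite lerBlDr (le_trans _ (lerD (fC _) (lexx _)))//.
  by rewrite -{1}(subrK v u) fD.
move=> v; apply/(@cvgrPdist_le _ _ _ (nbhs v)) => e e0; near=> u.
rewrite (le_trans (flip _ _))// (@le_trans _ _ ((C + 1) * `|v - u|))//.
  by rewrite ler_wpM2r// lerDl.
rewrite mulrC -ler_pdivlMr ?ltr_wpDl//.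
near: u; apply: (@cvgr_dist_le _ _ _ (nbhs v) _ id) => //.
by rewrite divr_gt0// ltr_wpDl.
Unshelve. all: by end_near. Qed.

(* [z0] is a maximizer of [b / rho] on the sphere of the coordinate sup norm, so
   equivalence of norms is not needed. *)
Lemma dual_norm_attained (R : realType) (X : vectType R) (rho : X -> R)
    (b : {scalar X}) :
  (exists x : X, x != 0) -> is_norm rho ->
  exists z0 : X, [/\ rho z0 = 1, b z0 = dual_norm rho b &
    forall z, b z <= dual_norm rho b * rho z].
Proof.
move=> [x x0] [rho0 rho_eq0 rhoZ rhoD].
have rho_gt0 z : z != 0 -> 0 < rho z.
  move=> z0; rewrite lt_neqAle rho0 andbT eq_sym.
  by apply: contra_neq z0 => /rho_eq0.
pose n := dim X; pose rhov (v : 'rV[R]_n) := rho (@r2v R X v).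
pose bv (v : 'rV[R]_n) : R := b (@r2v R X v).
have rhov_cont : continuous rhov.
  apply: sublinear_rV_continuous => [u v|c u c0]; rewrite /rhov.
    by rewrite linearD rhoD.
  by rewrite linearZ rhoZ ger0_norm.
have bv_cont : continuous bv.
  apply: sublinear_rV_continuous => [u v|c u c0]; rewrite /bv.
    by rewrite !linearD.
  by rewrite linearZ scalarZ.
pose S := [set v : 'rV[R]_n | `|v| = 1].
have v0 : v2r x != 0.
  by apply: contra_neq x0 => vx0; apply: v2r_inj; rewrite vx0 linear0.
have S0 : S !=set0.
  exists (`|v2r x|^-1 *: v2r x).
  by rewrite /S/= normrZ normfV normr_id mulVf// normr_eq0.
have cS : compact S.
  apply: bounded_closed_compact.
    exists 1; split; first exact: real1.
    by move=> M M1 v /= ->; exact: ltW.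
  rewrite (_ : S = Num.norm @^-1` [set 1])//.
  by apply: closed_comp; [move=> v _; exact: norm_continuous|exact: closed_eq].
have S_neq0 v : S v -> @r2v R X v != 0.
  move=> Sv; apply/eqP => v_eq0; have : v = 0.
    by apply: (can_inj r2vK); rewrite v_eq0 linear0.
  move=> v00; move: Sv; rewrite /S/= v00 normr0 => /esym/eqP.
  by rewrite oner_eq0.
have quot_cont : {within S, continuous (fun v => bv v / rhov v)}.
  apply: continuous_in_subspaceT => v; rewrite inE => Sv.
  apply: (@continuousM _ _ bv (fun v => (rhov v)^-1)); first exact: bv_cont.
  by apply: continuousV; [rewrite gt_eqF ?rho_gt0 ?S_neq0|exact: rhov_cont].
have [c] := EVT_max_rV S0 cS quot_cont; rewrite inE => Sc cmax.
pose z0 : X := (rhov c)^-1 *: @r2v R X c.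
have rhoc0 : 0 < rhov c by rewrite rho_gt0 ?S_neq0.
have rho_z0 : rho z0 = 1.
  by rewrite rhoZ normfV gtr0_norm// mulVf ?gt_eqF.
have b_le z : b z <= b z0 * rho z.
  have [->|z_neq0] := eqVneq z 0.
    rewrite -(scale0r (0 : X)) scalarZ rhoZ normr0 !mul0r mulr0.
    exact: lexx.
  have vz0 : v2r z != 0.
    by apply: contra_neq z_neq0 => vz0; apply: v2r_inj; rewrite vz0 linear0.
  have nz0 : 0 < `|v2r z| by rewrite normr_gt0.
  (* The quotient of [b] by [rho] is unchanged by positive scaling, so its maximum on the sphere
     bounds it at every nonzero [z]. *)
  have := cmax (`|v2r z|^-1 *: v2r z).
  rewrite inE /S/= normrZ normfV normr_id mulVf ?gt_eqF// => /(_ erefl).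
  rewrite /bv /rhov linearZ/= v2rK scalarZ rhoZ normfV normr_id.
  rewrite invfM invrK mulrACA mulVf ?gt_eqF// mul1r ler_pdivrMr ?rho_gt0//.
  by move=> h; rewrite scalarZ /rhov (mulrC _^-1).
(* At [- z0] the bound reads [- b z0 <= b z0]. This sign turns the bound by [b z0 * rho z] into a
   bound by [b z0] on the unit ball. *)
have b_z0 : 0 <= b z0.
  have := b_le (- z0); rewrite -scaleN1r scalarZ rhoZ normrN normr1 rho_z0.
  by rewrite mulN1r !mulr1 => ?; lra.
suff bE : dual_norm rho b = b z0 by exists z0; rewrite bE.
rewrite /dual_norm; set A := (X in sup X).
have Aub : ubound A (b z0).
  by move=> _ [z /= z1 <-]; rewrite (le_trans (b_le z))// ler_piMr.
have Az0 : A (b z0) by exists z0 => //=; rewrite rho_z0.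
apply/eqP; rewrite eq_le; apply/andP; split.
  by apply: ge_sup => //; exists (b z0).
by apply: ub_le_sup => //; exists (b z0).
Qed.

(** * The gap and the scalar reduction *)

Lemma convex_halfline_chord (R : realType) (f : R -> R) :
  convex_function (`[0, +oo[%classic : set R) f ->
  forall r s t : R, 0 <= r -> r < s -> s < t ->
    f s * (t - r) <= f r * (t - s) + f t * (s - r).
Proof.
move=> fconv r s t r0 rs st.
have rt : 0 < t - r by lra.
have p0 : 0 <= (t - s) / (t - r) by apply: divr_ge0; lra.
have p1 : (t - s) / (t - r) <= 1 by rewrite ler_pdivrMr//; lra.
have := fconv (Itv01 p0 p1) r t.
rewrite !inE /= !in_itv /= !andbT => /(_ r0 (ltac:(lra))).
rewrite [X in f X <= _]convRE convRE/= /unstable.onem.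
have -> : (t - s) / (t - r) * r + (1 - (t - s) / (t - r)) * t = s.
  by field; lra.
rewrite -(ler_pM2r rt) => /le_trans; apply.
by rewrite le_eqVlt; apply/orP; left; apply/eqP; field; lra.
Qed.

Section gap.
Context (R : realType) (phi : R -> R) (L gamma : R).
Hypothesis phi_convex : convex_function (`[0, +oo[%classic : set R) phi.
Hypothesis phi_gamma : phi r - L * r @[r --> +oo] --> gamma.

(** A rise of [phi t - L * t] between [r] and [s] would, by convexity, persist with at least the
    same slope and contradict convergence to [gamma]. *)
Lemma gap_nonincreasing (r s : R) :
  0 <= r -> r <= s -> gap phi L gamma s <= gap phi L gamma r.
Proof.
move=> r0; case: (ltgtP r s) => // [rs _|-> _]; last exact: lexx.
rewrite /gap lerD2r leNgt; apply/negP => lt_rs.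
pose e := (phi s - L * s) - (phi r - L * r).
have e0 : 0 < e by rewrite /e; lra.
near +oo_R => t.
have st : s < t by near: t; apply: nbhs_pinfty_gt; exact: num_real.
have gt1 : phi t - L * t < gamma + 1.
  by near: t; apply: (cvgr_lt gamma) => //; rewrite ltrDl.
(* Beyond this point the chord through [r] and [s] already lies above [gamma + 1]. *)
have tbig : r + (s - r) * (gamma + 1 - (phi r - L * r)) / e < t.
  by near: t; apply: nbhs_pinfty_gt; exact: num_real.
have chord := convex_halfline_chord phi_convex r0 rs st.
have : e * (t - r) <= (s - r) * (gamma + 1 - (phi r - L * r)).
  apply: (@le_trans _ _ ((s - r) * ((phi t - L * t) - (phi r - L * r)))).
    by rewrite /e; nra.
  by rewrite ler_pM2l; lra.
move: tbig; rewrite addrC -ltrBrDr ltr_pdivrMr// mulrC; lra.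
Unshelve. all: by end_near. Qed.

Lemma gap_ge0 (r : R) : 0 <= r -> 0 <= gap phi L gamma r.
Proof.
move=> r0; rewrite /gap subr_ge0; apply: (cvgr_to_le phi_gamma).
near=> s; have rs : r <= s by near: s; apply: nbhs_pinfty_ge; exact: num_real.
by have := gap_nonincreasing r0 rs; rewrite /gap lerD2r.
Unshelve. all: by end_near. Qed.

Hypothesis phi_ndecr : {in `[0, +oo[ &, {homo phi : r s / r <= s}}.

(** The extreme value theorem applies on [[0, M]], and beyond [M] the penalty alone makes [J] exceed
    its value at 0. *)
Lemma minimizers_J_neq0 (a q lambda : R) : 0 < a -> 0 < q -> 0 < lambda ->
  minimizers (@halfline R) (J phi L gamma a q lambda) !=set0.
Proof.
move=> a0 q0 l0.
(* Monotonicity of [phi] bounds the increment below by 0 and that of the gap bounds it above. This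
   excludes the jump at 0 that convexity alone would permit. *)
have lip (r s : R) : 0 <= r -> r <= s -> `|phi s - phi r| <= L * (s - r).
  move=> r0 rs; have s0 := le_trans r0 rs.
  have := gap_nonincreasing r0 rs; rewrite /gap.
  have := @phi_ndecr r s; rewrite !in_itv/= !andbT => /(_ r0 s0 rs) rsphi.
  by rewrite ger0_norm; lra.
have L0 : 0 <= L.
  by have := lip 0 1 (lexx _) ler01; have := normr_ge0 (phi 1 - phi 0); lra.
(* A general filter on nonnegative points serves both the neighbourhoods of a positive point and the
   right neighbourhoods of 0. *)
have phi_cont (x : R) (F : set_system R) : ProperFilter F -> 0 <= x ->
    y @[y --> F] --> x -> (\forall y \near F, 0 <= y) ->
    phi y @[y --> F] --> phi x.
  move=> FF x0 Fx F0; apply/cvgrPdist_le => e e0; near=> y.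
  have y0 : 0 <= y by near: y.
  have : L * `|x - y| <= e.
    apply: (@le_trans _ _ ((L + 1) * `|x - y|)).
      by rewrite ler_wpM2r// lerDl.
    rewrite mulrC -ler_pdivlMr ?ltr_wpDl//; near: y.
    by apply: (@cvgr_dist_le _ _ _ F _ id x Fx); rewrite divr_gt0// ltr_wpDl.
  apply: le_trans; have [xy|/ltW yx] := leP x y.
    by rewrite distrC [in leRHS]distrC [in leRHS]ger0_norm ?subr_ge0// lip.
  by rewrite [in leRHS]ger0_norm ?subr_ge0// lip.
pose M := (1 + a * gap phi L gamma 0 * (q / lambda)) `^ q^-1.
have M1 : 0 < 1 + a * gap phi L gamma 0 * (q / lambda).
  apply: ltr_wpDr => //; apply: mulr_ge0; last by apply: divr_ge0; exact: ltW.
  by apply: mulr_ge0; [exact: ltW|exact: gap_ge0].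
have M0 : 0 < M by exact: powR_gt0.
have Jcont : {within `[0, M], continuous (J phi L gamma a q lambda)}.
  have Jcvg (x : R) (F : set_system R) : ProperFilter F -> 0 <= x ->
      y @[y --> F] --> x -> (\forall y \near F, 0 <= y) ->
      y `^ q @[y --> F] --> x `^ q ->
      J phi L gamma a q lambda y @[y --> F] --> J phi L gamma a q lambda x.
    move=> FF x0 Fx F0 powx; rewrite /J /gap.
    apply: cvgD; last by apply: cvgM => //; exact: cvg_cst.
    apply: cvgD; first exact: cvg_cst.
    apply: cvgM; first exact: cvg_cst.
    apply: cvgB; last exact: cvg_cst.
    apply: cvgB; first exact: phi_cont.
    by apply: cvgM => //; exact: cvg_cst.
  have Jpos (x : R) : 0 < x -> {for x, continuous (J phi L gamma a q lambda)}.
    move=> x0; apply: (Jcvg _ (nbhs x)); [exact: ltW|exact: cvg_id| |].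
      by near=> y; apply: ltW; near: y; exact: lt_nbhsr.
    have /derivable1_diffP/differentiable_continuous// :
      derivable (fun y : R => y `^ q) x 1.
    by apply: derivable_powR; rewrite in_itv/= x0.
  apply/continuous_within_itvP => //; split.
  - by move=> x; rewrite in_itv/= => /andP[x0 _]; exact: Jpos.
  - apply: Jcvg => //.
    + by apply: cvg_at_right_filter; exact: cvg_id.
    + by near=> y; apply: ltW; near: y; exact: nbhs_right_gt.
    + by rewrite powR0 ?gt_eqF//; exact: powR_cvg0.
  - by apply: cvg_at_left_filter; exact: Jpos.
have [c cM cmin] := EVT_min (ltW M0) Jcont.
have c0 : 0 <= c by move: cM; rewrite in_itv/= => /andP[].
exists c; split => // y; rewrite /halfline/= => y0.
have [yM|My] := leP y M; first by apply: cmin; rewrite in_itv/= y0.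
apply: (@le_trans _ _ (J phi L gamma a q lambda 0)).
  by apply: cmin; rewrite in_itv/= lexx ltW.
rewrite /J powR0 ?gt_eqF// mulr0 addr0 -addrA lerD2l.
rewrite ler_wpDl ?mulr_ge0 ?gap_ge0 ?(ltW a0)//.
have : M `^ q <= y `^ q.
  by rewrite ge0_ler_powR ?nnegrE ?(ltW q0) ?(ltW M0) ?(ltW My).
rewrite /M -powRrM mulVf ?gt_eqF// powRr1 ?(ltW M1)// => yq.
have lq0 : 0 < lambda / q by rewrite divr_gt0.
apply: le_trans (ler_wpM2l (ltW lq0) yq).
have -> : lambda / q * (1 + a * gap phi L gamma 0 * (q / lambda)) =
  lambda / q + a * gap phi L gamma 0 by field; lra.
by rewrite lerDr ltW.
Unshelve. all: by end_near. Qed.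

End gap.

(** A minimizer makes the set of values nonempty and bounded below, so the real-valued [inf] is not
    a default value. *)
Lemma minJE (R : realType) (phi : R -> R) (L gamma a q lambda r : R) :
  minimizers (@halfline R) (J phi L gamma a q lambda) r ->
  minJ phi L gamma a q lambda = J phi L gamma a q lambda r.
Proof.
move=> [r0 rmin]; rewrite /minJ; set A := (X in inf X).
have Alb : lbound A (J phi L gamma a q lambda r).
  by move=> _ [y y0 <-]; exact: rmin.
have Ar : A (J phi L gamma a q lambda r) by exists r.
apply/eqP; rewrite eq_le; apply/andP; split.
  by apply: ge_inf => //; exists (J phi L gamma a q lambda r).
by apply: lb_le_inf => //; exists (J phi L gamma a q lambda r).
Qed.

(** * Reduction of the epigraph problem to the radius *)

Section scalar_reduction.
Context (R : realType) (X : vectType R) (rho : X -> R) (phi : R -> R).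
Context (L gamma a q lambda : R) (b : {scalar X}) (z0 : X).
Hypotheses (rho_norm : is_norm rho) (a_gt0 : 0 < a).
Hypotheses (rho_z0 : rho z0 = 1) (b_z0 : b z0 = a * L).
Hypothesis b_le : forall z, b z <= a * L * rho z.

Lemma J_le_objective p : epi_constraint rho phi p ->
  J phi L gamma a q lambda (rho p.2) <= reg_objective rho a b q lambda p.
Proof.
case: p => t z /=; rewrite /epi_constraint/= => zt.
rewrite /J /reg_objective/= lerD2r /gap.
have := b_le (- z); rewrite -scaleN1r (is_normZ rho_norm) normrN1 mul1r.
rewrite scalarZ mulN1r => bz.
have : a * phi (rho z) <= a * t by rewrite ler_pM2l.
lra.
Qed.

(** Both losses in [J_le_objective] vanish for [t = phi r] on the boundary of the epigraph and [z] a
    multiple of [- z0]. *)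
Lemma objective_ray (r : R) : 0 <= r ->
  exists2 p, epi_constraint rho phi p /\ rho p.2 = r &
    reg_objective rho a b q lambda p = J phi L gamma a q lambda r.
Proof.
move=> r0; have rE : rho (- r *: z0) = r.
  by rewrite (is_normZ rho_norm) normrN ger0_norm// rho_z0 mulr1.
exists (phi r, - r *: z0); first by rewrite /epi_constraint/= rE.
rewrite /reg_objective /J /gap /= rE scalarZ b_z0; ring.
Qed.

(** With the infimum taken in the extended reals, the equality also asserts that it is finite. *)
Lemma ereal_inf_objective r :
  minimizers (@halfline R) (J phi L gamma a q lambda) r ->
  ereal_inf [set (reg_objective rho a b q lambda p)%:E
            | p in epi_constraint rho phi]
    = (minJ phi L gamma a q lambda)%:E.
Proof.
move=> rmin; rewrite (minJE rmin); have [r0 rle] := rmin.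
apply/eqP; rewrite eq_le; apply/andP; split.
  have [p [pC _] <-] := objective_ray r0.
  by apply: ereal_inf_lbound; exists p.
apply: le_ereal_inf_tmp => _ [p pC <-]; rewrite lee_fin.
rewrite (le_trans _ (J_le_objective pC))// rle//.
exact: is_norm_ge0 rho_norm _.
Qed.

Lemma minimizers_objective :
  [set rho p.2 | p in minimizers (epi_constraint rho phi)
                                 (reg_objective rho a b q lambda)]
    = minimizers (@halfline R) (J phi L gamma a q lambda).
Proof.
apply/seteqP; split => [_ [p [pC pmin] <-]|r [r0 rmin]].
  split=> [|s s0]; first exact: is_norm_ge0 rho_norm _.
  have [p' [p'C _] <-] := objective_ray s0.
  exact: le_trans (J_le_objective pC) (pmin _ p'C).
have [p [pC pr] pJ] := objective_ray r0.
exists p => //; split=> // p' p'C; rewrite pJ.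
apply: le_trans (J_le_objective p'C); apply: rmin.
exact: is_norm_ge0 rho_norm _.
Qed.

End scalar_reduction.

(** * Asymptotics of scaled minimizers *)

Lemma powR_expR (R : realType) (x p : R) : 0 < x -> x `^ p = expR (p * ln x).
Proof. by move=> x0; rewrite /powR gt_eqF. Qed.

Lemma powR_div (R : realType) (x y p : R) : 0 <= x -> 0 < y ->
  (x / y) `^ p = x `^ p * y `^ (- p).
Proof.
move=> x0 y0; rewrite -(powR_inv1 (ltW y0)) powRM ?powR_ge0//.
by rewrite -powRrM mulN1r.
Qed.

(** This is the square of the tangent inequality at [x / 2]; its quadratic term supplies the
    coercivity of the profile. *)
Lemma expR_ge1Dx_sqr (R : realType) (x : R) :
  0 <= x -> 1 + x + x ^+ 2 / 4 <= expR x.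
Proof.
move=> x0; have -> : 1 + x + x ^+ 2 / 4 = (1 + x / 2) ^+ 2 by field.
rewrite (_ : expR x = expR (x / 2) ^+ 2); last first.
  by rewrite expr2 -expRD; congr expR; field.
by rewrite lerXn2r ?nnegrE ?expR_ge0 ?expR_ge1Dx//; lra.
Qed.

(* In [u = ln s] the linear terms of the two exponentials cancel, and the one
   with nonnegative exponent contributes its quadratic term. *)
Lemma power_profile_gap (R : realType) (nu q s : R) :
  0 < nu -> 0 < q -> 0 < s ->
  nu / 4 * Num.min nu q * ln s ^+ 2 <=
    s `^ (- nu) + nu / q * s `^ q - (1 + nu / q).
Proof.
move=> nu0 q0 s0; rewrite !powR_expR//; move: (ln s) => u.
have nuq : 0 < nu / q by rewrite divr_gt0.
have nuqE : nu / q * q = nu by field; lra.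
have u2 : 0 <= u ^+ 2 by exact: sqr_ge0.
have [u0|/ltW u0] := leP 0 u.
  have hq : nu / q * (1 + q * u + (q * u) ^+ 2 / 4) <= nu / q * expR (q * u).
    by rewrite ler_pM2l// expR_ge1Dx_sqr// mulr_ge0// ltW.
  have hnu := expR_ge1Dx (- nu * u).
  have : nu / 4 * Num.min nu q * u ^+ 2 <= nu / 4 * q * u ^+ 2.
    by rewrite ler_wpM2r// ler_pM2l ?divr_gt0// ge_min lexx orbT.
  have : nu / q * (1 + q * u + (q * u) ^+ 2 / 4) =
      nu / q + nu * u + nu / 4 * q * u ^+ 2 by field; lra.
  lra.
have hq : nu / q * (1 + q * u) <= nu / q * expR (q * u).
  by rewrite ler_pM2l// expR_ge1Dx.
have hnu : 1 + (- nu * u) + (- nu * u) ^+ 2 / 4 <= expR (- nu * u).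
  by apply: expR_ge1Dx_sqr; rewrite mulNr -mulrN mulr_ge0 ?oppr_ge0// ltW.
have : nu / 4 * Num.min nu q * u ^+ 2 <= nu / 4 * nu * u ^+ 2.
  by rewrite ler_wpM2r// ler_pM2l ?divr_gt0// ge_min lexx.
have -> : nu / 4 * nu * u ^+ 2 = (- nu * u) ^+ 2 / 4 by field.
have : nu / q * (1 + q * u) = nu / q + nu * u by field; lra.
lra.
Qed.

(** * Comparison with the competitor [scale] along a general filter *)

Section scaled_minimizers.
Context (R : realType) (T : Type) (F : set_system T) {FF : ProperFilter F}.
Context (d : R -> R) (nu kappa q : R) (scale r_ : T -> R).
Hypotheses (nu_gt0 : 0 < nu) (kappa_gt0 : 0 < kappa) (q_gt0 : 0 < q).
Hypothesis d_nonincr : forall r s : R, 0 <= r -> r <= s -> d s <= d r.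
Hypothesis d_asymp : asymp +oo d (fun r => kappa * r `^ (- nu)).
Hypothesis scale_pinfty : scale x @[x --> F] --> +oo.
Hypothesis r_ge0 : \forall x \near F, 0 <= r_ x.
(** Minimality enters only through this comparison of rescaled objectives; at the competitor the
    power term is exactly [nu / q]. *)
Hypothesis r_le : \forall x \near F,
  d (r_ x) / (kappa * scale x `^ (- nu)) + nu / q * (r_ x / scale x) `^ q
    <= d (scale x) / (kappa * scale x `^ (- nu)) + nu / q.

Let scale_gt (c : R) : \forall x \near F, c < scale x.
Proof. by move/cvgryPgt : scale_pinfty => /(_ c). Qed.

(** Normalizing [d r] at [r] instead of [u] makes its asymptotics applicable and leaves a pure power
    of the ratio. *)
Let ratio_scale (r u : R) : 0 < r -> 0 < u ->
  d r / (kappa * u `^ (- nu)) =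
  d r / (kappa * r `^ (- nu)) * (r / u) `^ (- nu).
Proof.
move=> r0 u0; rewrite powR_div ?(ltW r0)// opprK !powRN; field.
by rewrite !gt_eqF ?powR_gt0.
Qed.

(* Below [delta * scale] the term [d] alone already exceeds the value at
   [scale], so minimizers go to infinity and the asymptotics of [d] applies. *)
Let delta : R := (2 * (1 + nu / q)) `^ (- nu^-1).

Let delta_gt0 : 0 < delta.
Proof. by rewrite powR_gt0// mulr_gt0// ltr_wpDr// ltW// divr_gt0. Qed.

Let deltaN : delta `^ (- nu) = 2 * (1 + nu / q).
Proof.
have nuq : 0 < nu / q by rewrite divr_gt0.
by rewrite /delta -powRrM mulrNN mulVf ?gt_eqF// powRr1//; lra.
Qed.

Let d_scale_cvg (c : R) : 0 < c ->
  d (c * scale x) / (kappa * (c * scale x) `^ (- nu)) @[x --> F] --> (1 : R).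
Proof.
move=> c0; apply: (@cvg_comp _ _ _ (fun x => c * scale x)
  (fun r => d r / (kappa * r `^ (- nu))) F +oo); last exact: d_asymp.
apply/cvgryPgt => A; near=> x.
by rewrite mulrC -ltr_pdivrMr//; near: x; exact: scale_gt.
Unshelve. all: by end_near. Qed.

Let d_scale1_cvg :
  d (scale x) / (kappa * scale x `^ (- nu)) @[x --> F] --> (1 : R).
Proof.
have := d_scale_cvg ltr01.
by under eq_fun do rewrite mul1r.
Qed.

Let r_gt : \forall x \near F, delta * scale x < r_ x.
Proof.
near=> x; rewrite ltNge; apply/negP => rx.
have r0 : 0 <= r_ x by near: x.
have s0 : 0 < scale x by near: x; exact: scale_gt.
have nuq : 0 < nu / q by rewrite divr_gt0.
have M : d (scale x) / (kappa * scale x `^ (- nu)) < 1 + 4^-1.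
  by near: x; apply: (cvgr_lt (1 : R) d_scale1_cvg); rewrite ltrDl invr_gt0.
have D : 3 / 4 < d (delta * scale x) / (kappa * (delta * scale x) `^ (- nu)).
  by near: x; apply: (cvgr_gt (1 : R) (d_scale_cvg delta_gt0)); lra.
have K0 : 0 < kappa * scale x `^ (- nu) by rewrite mulr_gt0 ?powR_gt0.
have le1 : d (delta * scale x) / (kappa * scale x `^ (- nu)) <=
    d (r_ x) / (kappa * scale x `^ (- nu)).
  by rewrite ler_pM2r ?invr_gt0// d_nonincr.
have le2 : d (r_ x) / (kappa * scale x `^ (- nu)) +
    nu / q * (r_ x / scale x) `^ q <=
    d (scale x) / (kappa * scale x `^ (- nu)) + nu / q by near: x.
have q_ge0 : 0 <= nu / q * (r_ x / scale x) `^ q.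
  by rewrite mulr_ge0 ?powR_ge0 ?(ltW nuq).
move: le1; rewrite ratio_scale ?mulr_gt0// mulfK ?gt_eqF// deltaN => le1.
have : 3 / 4 * (2 * (1 + nu / q)) <
    d (delta * scale x) / (kappa * (delta * scale x) `^ (- nu)) *
    (2 * (1 + nu / q)) by rewrite ltr_pM2r//; lra.
lra.
Unshelve. all: by end_near. Qed.

Let d_r_cvg : d (r_ x) / (kappa * r_ x `^ (- nu)) @[x --> F] --> (1 : R).
Proof.
apply: (@cvg_comp _ _ _ r_ (fun r => d r / (kappa * r `^ (- nu))) F +oo);
  last exact: d_asymp.
apply/cvgryPgt => A; near=> x; apply: (@lt_trans _ _ (delta * scale x)).
  by rewrite mulrC -ltr_pdivrMr//; near: x; exact: scale_gt.
by near: x; exact: r_gt.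
Unshelve. all: by end_near. Qed.

Let ln_ratio_cvg : ln (r_ x / scale x) @[x --> F] --> (0 : R).
Proof.
pose c := nu / 4 * Num.min nu q.
have c0 : 0 < c by rewrite mulr_gt0 ?divr_gt0// lt_min nu_gt0.
pose M x := d (scale x) / (kappa * scale x `^ (- nu)).
pose h x := d (r_ x) / (kappa * r_ x `^ (- nu)).
pose err x := (M x - 1) + `|1 - h x| * (2 * (1 + nu / q)).
have err0 : err x @[x --> F] --> (0 : R).
  rewrite [X in _ --> X](_ : 0 = (1 - 1) + `|1 - 1 : R| * (2 * (1 + nu / q))).
    apply: cvgD; first by apply: cvgB; [exact: d_scale1_cvg|exact: cvg_cst].
    apply: cvgM; last exact: cvg_cst.
    by apply: cvg_norm; apply: cvgB; [exact: cvg_cst|exact: d_r_cvg].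
  by rewrite subrr normr0 mul0r addr0.
apply/cvgrPdist_lt => e e0; near=> x; rewrite sub0r normrN.
have s0 : 0 < scale x by near: x; exact: scale_gt.
have rx : delta * scale x < r_ x by near: x; exact: r_gt.
have r0 : 0 < r_ x by rewrite (lt_trans _ rx)// mulr_gt0.
have ratio0 : 0 < r_ x / scale x by rewrite divr_gt0.
have le2 : d (r_ x) / (kappa * scale x `^ (- nu)) +
    nu / q * (r_ x / scale x) `^ q <= M x + nu / q by near: x.
have profile := power_profile_gap nu_gt0 q_gt0 ratio0.
have sN : (r_ x / scale x) `^ (- nu) <= 2 * (1 + nu / q).
  rewrite -deltaN !powRN.
  rewrite lef_pV2 ?posrE ?(powR_gt0 _ ratio0) ?(powR_gt0 _ delta_gt0)//.
  rewrite ge0_ler_powR ?nnegrE ?(ltW nu_gt0) ?(ltW delta_gt0) ?(ltW ratio0)//.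
  by rewrite ler_pdivlMr// ltW.
have hs : (1 - h x) * (r_ x / scale x) `^ (- nu) <=
    `|1 - h x| * (2 * (1 + nu / q)).
  apply: le_trans (ler_wpM2l (normr_ge0 _) sN).
  by rewrite ler_wpM2r ?powR_ge0 ?ler_norm.
have errx : err x < c * e ^+ 2.
  by near: x; apply: (cvgr_lt (0 : R) err0); rewrite mulr_gt0 ?exprn_gt0.
rewrite ratio_scale// -/(h x) in le2.
have : c * ln (r_ x / scale x) ^+ 2 < c * e ^+ 2.
  by move: errx profile; rewrite /err /c; lra.
rewrite ltr_pM2l// -real_normK ?num_real// ltr_pXn2r ?nnegrE//; exact: ltW.
Unshelve. all: by end_near. Qed.

(** The exponents 1, [- nu] and [q] give the radius, the gap and the penalty respectively. *)
Let ratio_powR_cvg (p : R) : (r_ x / scale x) `^ p @[x --> F] --> (1 : R).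
Proof.
apply: (@cvg_trans _ (expR (p * ln (r_ x / scale x)) @[x --> F])).
  apply: near_eq_cvg; near=> x; rewrite powR_expR// divr_gt0//.
    have s0 : 0 < scale x by near: x; exact: scale_gt.
    rewrite (@lt_trans _ _ (delta * scale x)) ?mulr_gt0//.
    by near: x; exact: r_gt.
  by near: x; exact: scale_gt.
rewrite -expR0 -(mulr0 p).
apply: (@cvg_comp _ _ _ _ expR); last exact: continuous_expR.
by apply: cvgM; [exact: cvg_cst|exact: ln_ratio_cvg].
Unshelve. all: by end_near. Qed.

Lemma scaled_minimizer_asymp : asymp F r_ scale.
Proof.
rewrite /asymp; apply: cvg_trans (ratio_powR_cvg 1).
apply: near_eq_cvg; near=> x; rewrite powRr1// divr_ge0//; first by near: x.
by apply: ltW; near: x; exact: scale_gt.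
Unshelve. all: by end_near. Qed.

Lemma scaled_minimizer_value_asymp :
  asymp F (d \o r_) (fun x => kappa * scale x `^ (- nu)).
Proof.
rewrite /asymp/=.
apply: (@cvg_trans _ (d (r_ x) / (kappa * r_ x `^ (- nu)) *
  (r_ x / scale x) `^ (- nu) @[x --> F])).
  apply: near_eq_cvg; near=> x; have s0 : 0 < scale x.
    by near: x; exact: scale_gt.
  have r0 : 0 < r_ x.
    rewrite (@lt_trans _ _ (delta * scale x)) ?mulr_gt0//.
    by near: x; exact: r_gt.
  by rewrite -(ratio_scale r0 s0).
have := cvgM d_r_cvg (ratio_powR_cvg (- nu)); rewrite mulr1; exact.
Unshelve. all: by end_near. Qed.

Lemma scaled_min_asymp :
  asymp F (fun x => d (r_ x) / (kappa * scale x `^ (- nu)) +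
    nu / q * (r_ x / scale x) `^ q) (fun=> 1 + nu / q).
Proof.
have G0 : 1 + nu / q != 0 by rewrite gt_eqF// addr_gt0// divr_gt0.
rewrite /asymp -[X in _ --> X](mulfV G0); apply: cvgM; last exact: cvg_cst.
apply: cvgD; first exact: scaled_minimizer_value_asymp.
rewrite -[X in _ --> X]mulr1; apply: cvgM; first exact: cvg_cst.
exact: ratio_powR_cvg.
Qed.

End scaled_minimizers.

(** * Escape rate of the regularization path *)

(** For [K = a * nu * kappa] and [p = nu + q] this is the critical point of [a * kappa * r]^ (- nu)
    + lambda / q * r [^ q]. *)
Definition escape_scale (R : realType) (K p lambda : R) : R :=
  (K / lambda) `^ p^-1.

Lemma escape_scale_pinfty (R : realType) (K p : R) : 0 < K -> 0 < p ->
  escape_scale K p lambda @[lambda --> 0^'+] --> +oo.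
Proof.
move=> K0 p0; apply/cvgryPgt => A; near=> l.
have l0 : 0 < l by near: l; exact: nbhs_right_gt.
(* Replacing [A] by a positive bound allows it to be written as a [p]-th root; the condition becomes
   an upper bound on [l]. *)
have A0 : 0 < `|A| + 1 by rewrite ltr_wpDl.
apply: (@le_lt_trans _ _ `|A|); first exact: ler_norm.
apply: (@lt_trans _ _ (`|A| + 1)); first by rewrite ltrDl.
have -> : `|A| + 1 = ((`|A| + 1) `^ p) `^ p^-1.
  by rewrite -powRrM mulfV ?gt_eqF// powRr1// ltW.
rewrite gt0_ltr_powR ?nnegrE ?invr_gt0 ?powR_ge0//.
  by rewrite divr_ge0 ?(ltW K0) ?(ltW l0).
rewrite ltr_pdivlMr// mulrC -ltr_pdivlMr ?powR_gt0//.
by near: l; apply: nbhs_right_lt; rewrite divr_gt0 ?powR_gt0.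
Unshelve. all: by end_near. Qed.

Lemma escape_scaleN (R : realType) (K p nu lambda : R) : 0 < K -> 0 < lambda ->
  escape_scale K p lambda `^ (- nu) = (lambda / K) `^ (nu / p).
Proof.
move=> K0 l0; have Kl0 : 0 <= K / lambda by rewrite divr_ge0 ?ltW.
rewrite /escape_scale -[lambda / K]invf_div -(powR_inv1 Kl0) -!powRrM.
by congr (_ `^ _); rewrite mulN1r mulrN mulrC.
Qed.

Lemma J_scaled (R : realType) (phi : R -> R) (L gamma nu kappa a q : R)
    (lambda r : R) :
  0 < nu -> 0 < kappa -> 0 < a -> 0 < q -> 0 < lambda -> 0 <= r ->
  let u := escape_scale (a * nu * kappa) (nu + q) lambda in
  J phi L gamma a q lambda r - a * gamma = a * (kappa * u `^ (- nu)) *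
    (gap phi L gamma r / (kappa * u `^ (- nu)) + nu / q * (r / u) `^ q).
Proof.
move=> nu0 kappa0 a0 q0 l0 r0 u.
have K0 : 0 < a * nu * kappa by rewrite !mulr_gt0.
have u0 : 0 < u by rewrite powR_gt0// divr_gt0.
have lE : lambda = a * nu * kappa * u `^ (- nu) * u `^ (- q).
  rewrite -mulrA -powRD; last by rewrite (gt_eqF u0) implybT.
  rewrite -opprD /u escape_scaleN//.
  rewrite mulfV ?gt_eqF ?addr_gt0// powRr1 ?divr_ge0 ?ltW//.
  by field; rewrite !gt_eqF.
clearbody u; rewrite /J powR_div// {1}lE.
have uN0 : u `^ (- nu) != 0 by rewrite gt_eqF ?powR_gt0.
move: (u `^ (- nu)) (u `^ (- q)) uN0 => x y x0.
by field; rewrite x0 !gt_eqF.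
Qed.

(** Only the quotients need agree, so common factors may be moved in or out of both sides. *)
Lemma asymp_near_eq (R : realType) (T : Type) (F : set_system T)
    (f g f' g' : T -> R) : Filter F ->
  (\forall x \near F, f x / g x = f' x / g' x) -> asymp F f g -> asymp F f' g'.
Proof. by move=> FF fg; apply: cvg_trans; exact: near_eq_cvg. Qed.

Section path_asymptotics.
Context (R : realType) (phi : R -> R) (L gamma nu kappa a q : R).
Hypothesis phi_convex : convex_function (`[0, +oo[%classic : set R) phi.
Hypothesis phi_gamma : phi r - L * r @[r --> +oo] --> gamma.
Hypotheses (nu_gt0 : 0 < nu) (kappa_gt0 : 0 < kappa).
Hypothesis gap_asymp :
  asymp +oo (gap phi L gamma) (fun r => kappa * r `^ (- nu)).
Hypotheses (a_gt0 : 0 < a) (q_gt0 : 0 < q).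
Context (r_ : R -> R).
Hypothesis r_min : forall lambda, 0 < lambda ->
  minimizers (@halfline R) (J phi L gamma a q lambda) (r_ lambda).

Let K := a * nu * kappa.
Let K_gt0 : 0 < K. Proof. by rewrite !mulr_gt0. Qed.
Let scale := escape_scale K (nu + q).
Let nuq_gt0 : 0 < nu + q. Proof. exact: addr_gt0. Qed.

Let scale_gt0 lambda : 0 < lambda -> 0 < scale lambda.
Proof. by move=> l0; rewrite powR_gt0// divr_gt0. Qed.

Let scale_pinfty : scale x @[x --> 0^'+] --> +oo.
Proof. exact: escape_scale_pinfty. Qed.

Let r_ge0 : \forall x \near 0^'+, 0 <= r_ x.
Proof.
near=> x; have x0 : 0 < x by near: x; exact: nbhs_right_gt.
by have [] := r_min x0.
Unshelve. all: by end_near. Qed.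

(** Minimality against [scale x] is divided by the positive common factor from [J_scaled]. *)
Let r_le : \forall x \near 0^'+,
  gap phi L gamma (r_ x) / (kappa * scale x `^ (- nu)) +
  nu / q * (r_ x / scale x) `^ q <=
  gap phi L gamma (scale x) / (kappa * scale x `^ (- nu)) + nu / q.
Proof.
near=> x; have x0 : 0 < x by near: x; exact: nbhs_right_gt.
have [r0 rmin] := r_min x0; have u0 := scale_gt0 x0.
have := rmin _ (ltW u0); rewrite -(lerD2r (- (a * gamma))).
rewrite !(J_scaled phi L gamma nu_gt0 kappa_gt0)// ?(ltW u0)//.
rewrite -/K -/scale -/(scale x).
rewrite ler_pM2l; last by rewrite mulr_gt0// mulr_gt0// powR_gt0.
by rewrite divff ?gt_eqF// powR1 mulr1.
Unshelve. all: by end_near. Qed.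

Let gap_nonincr (r s : R) : 0 <= r -> r <= s ->
  gap phi L gamma s <= gap phi L gamma r.
Proof. exact: gap_nonincreasing. Qed.

Lemma minimizer_asymp :
  asymp 0^'+ r_ (fun lambda => (K / lambda) `^ (nu + q)^-1).
Proof.
exact: (scaled_minimizer_asymp nu_gt0 kappa_gt0 q_gt0
  gap_nonincr gap_asymp scale_pinfty r_ge0 r_le).
Qed.

Lemma gap_minimizer_asymp :
  asymp 0^'+ (fun lambda => a * gap phi L gamma (r_ lambda))
    (fun lambda => a * kappa * (lambda / K) `^ (nu / (nu + q))).
Proof.
apply: asymp_near_eq (scaled_minimizer_value_asymp
  nu_gt0 kappa_gt0 q_gt0 gap_nonincr gap_asymp scale_pinfty r_ge0 r_le).
near=> x; have x0 : 0 < x by near: x; exact: nbhs_right_gt.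
rewrite /= -escape_scaleN// -/scale -/(scale x) -(mulrA a kappa).
by rewrite -mulf_div divff ?gt_eqF// mul1r.
Unshelve. all: by end_near. Qed.

Lemma minJ_asymp :
  asymp 0^'+ (fun lambda => minJ phi L gamma a q lambda - a * gamma)
    (fun lambda => (1 + nu / q) * (a * kappa) *
      (lambda / K) `^ (nu / (nu + q))).
Proof.
apply: asymp_near_eq (scaled_min_asymp
  nu_gt0 kappa_gt0 q_gt0 gap_nonincr gap_asymp scale_pinfty r_ge0 r_le).
near=> x; have x0 : 0 < x by near: x; exact: nbhs_right_gt.
have [r0 _] := r_min x0.
rewrite (minJE (r_min x0)) (J_scaled phi L gamma nu_gt0 kappa_gt0)//.
rewrite -escape_scaleN// -/K -/scale -/(scale x).
have : scale x `^ (- nu) != 0 by rewrite gt_eqF// powR_gt0 ?scale_gt0.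
move: (scale x `^ (- nu)) ((r_ x / scale x) `^ q) (gap _ _ _ _) => u p g u0.
by field; rewrite u0 !gt_eqF// addr_gt0.
Unshelve. all: by end_near. Qed.

End path_asymptotics.

Unset Implicit Arguments.
Set Strict Implicit.

Theorem theorem6p4 (R : realType) (X : vectType R) (rho : X -> R)
    (phi : R -> R) (L gamma nu kappa a q : R) (b : {scalar X})
    (X_neq0 : exists x : X, x != 0)
    (rho_norm : is_norm rho)
    (phi_convex : convex_function (`[0, +oo[%classic : set R) phi)
    (phi_ndecr : {in `[0, +oo[ &, {homo phi : r s / r <= s}})
    (L_gt0 : 0 < L)
    (phi_slope : phi r / r @[r --> +oo] --> L)
    (phi_gamma : phi r - L * r @[r --> +oo] --> gamma)
    (phi_neq : forall r, 0 <= r -> phi r - L * r <> gamma)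
    (nu_gt0 : 0 < nu) (kappa_gt0 : 0 < kappa)
    (gap_asymp :
      asymp +oo (gap phi L gamma) (fun r => kappa * r `^ (- nu)))
    (a_gt0 : 0 < a) (b_norm : dual_norm rho b = a * L) (q_gt1 : 1 < q) :
  [/\ (* positivity of d *)
      forall r, 0 <= r -> 0 < gap phi L gamma r,
      (* scalar reduction: same value, and same optimal radii *)
      forall lambda, 0 < lambda ->
        [/\ ereal_inf [set (reg_objective rho a b q lambda p)%:E
                      | p in epi_constraint rho phi]
              = (minJ phi L gamma a q lambda)%:E,
            [set rho p.2 | p in minimizers (epi_constraint rho phi)
                                           (reg_objective rho a b q lambda)]
              = minimizers (@halfline R) (J phi L gamma a q lambda)
          & minimizers (@halfline R) (J phi L gamma a q lambda) !=set0],
      (* asymptotics along any choice of minimizers of J *)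
      forall r_ : R -> R,
        (forall lambda, 0 < lambda ->
          minimizers (@halfline R) (J phi L gamma a q lambda) (r_ lambda)) ->
        [/\ asymp 0^'+ r_
              (fun lambda => (a * nu * kappa / lambda) `^ (nu + q)^-1),
            asymp 0^'+ (fun lambda => a * gap phi L gamma (r_ lambda))
              (fun lambda =>
                 a * kappa * (lambda / (a * nu * kappa)) `^ (nu / (nu + q)))
          & asymp 0^'+ (fun lambda => minJ phi L gamma a q lambda - a * gamma)
              (fun lambda =>
                 (1 + nu / q) * (a * kappa)
                   * (lambda / (a * nu * kappa)) `^ (nu / (nu + q)))]
    & (* escape rate of the regularization path *)
      forall p_ : R -> R * X,
        (forall lambda, 0 < lambda ->
          minimizers (epi_constraint rho phi)
            (reg_objective rho a b q lambda) (p_ lambda)) ->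
        asymp 0^'+ (fun lambda => rho (p_ lambda).2)
          (fun lambda =>
             (a * nu * kappa) `^ (nu + q)^-1 * lambda `^ (- (nu + q)^-1))].
Proof.
have q_gt0 : 0 < q by rewrite (lt_trans _ q_gt1).
have [z0 [rho_z0 b_z0 b_le]] := dual_norm_attained b X_neq0 rho_norm.
rewrite b_norm in b_z0 b_le.
have reduction lambda := minimizers_objective phi gamma q lambda
  rho_norm a_gt0 rho_z0 b_z0 b_le.
have r_asymp := minimizer_asymp phi_convex phi_gamma
  nu_gt0 kappa_gt0 gap_asymp a_gt0 q_gt0.
split => [r r0|lambda l0|r_ r_min|p_ p_min].
- rewrite lt_neqAle gap_ge0// andbT eq_sym.
  by apply/eqP => /subr0_eq; exact: phi_neq.
- have [r rmin] := minimizers_J_neq0 phi_convex phi_gamma phi_ndecr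
    a_gt0 q_gt0 l0.
  split; [|exact: reduction|by exists r].
  exact: (ereal_inf_objective rho_norm a_gt0 rho_z0 b_z0 b_le rmin).
- split; [exact: r_asymp| |].
    exact: (gap_minimizer_asymp phi_convex phi_gamma
      nu_gt0 kappa_gt0 gap_asymp a_gt0 q_gt0 r_min).
  exact: (minJ_asymp phi_convex phi_gamma
    nu_gt0 kappa_gt0 gap_asymp a_gt0 q_gt0 r_min).
(* By the reduction, the radii of the path are minimizers of [J], so the radius asymptotics apply;
   only the power of the quotient remains to be split. *)
- have r_min lambda : 0 < lambda -> minimizers (@halfline R)
      (J phi L gamma a q lambda) (rho (p_ lambda).2).
    by move=> l0; rewrite -reduction; exists (p_ lambda) => //; exact: p_min.
  apply: asymp_near_eq (r_asymp _ r_min); near=> x.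
  have x0 : 0 < x by near: x; exact: nbhs_right_gt.
  by rewrite powR_div// !mulr_ge0 ?ltW.
Unshelve. all: by end_near. Qed.
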